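(* Let $\mathcal{H}$ be a complex Hilbert space, let $A, B$ be invertible positive bounded operators on $\mathcal{H}$, and let $r$ be a real number. Then: (i) If $r \geq 2$, then $rA\# B + (1 - r)\frac{A + B}{2} \le \left( \frac{A^{-1} + B^{-1}}{2} \right)^{-1}$. (ii) If $r \leq 1$, then $rA\# B + (1 - r)\frac{A + B}{2} \ge \left( \frac{A^{-1} + B^{-1}}{2} \right)^{-1}$.
   Context: All operators are bounded operators on a complex Hilbert space $\mathcal{H}$. A self-adjoint operator $A$ is positive ($A\ge 0$) if $\langle x, Ax\rangle \geq 0$ for all $x \in \mathcal{H}$. For self-adjoint $A,B$, $A \geq B$ means $A-B \geq 0$. For invertible positive operators $A,B$, the geometric mean is $A\# B = A^{1/2}(A^{-1/2}BA^{-1/2})^{1/2}A^{1/2}$; the expression $rA\# B$ means $r\,(A\# B)$. *)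

(* Defs.v *)
From mathcomp Require Import all_boot all_order all_algebra.
From mathcomp Require Import sesquilinear.
From mathcomp Require Import all_classical all_reals all_analysis.
From mathcomp Require Import complex.

Set Implicit Arguments.
Unset Strict Implicit.
Unset Printing Implicit Defensive.

Import Order.TTheory GRing.Theory Num.Theory Num.Def.
Import numFieldNormedType.Exports.

Local Open Scope classical_set_scope.
Local Open Scope ring_scope.
Local Open Scope complex_scope.

(* A complex Hilbert space is a complete normed module H over R[i] whose norm
   is induced by a positive definite Hermitian form ip.  The forms of type
   {dot H for conjC} are linear in their first argument and conjugate-linear
   in the second. *)
Definition induces_norm (R : realType) (H : completeNormedModType R[i])
    (ip : {dot H for (@conjC R[i])}) : Prop :=
  forall x : H, `|x| ^+ 2 = ip x x.

Section Operators.
Context (R : realType) (H : completeNormedModType R[i]).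
Context (ip : {dot H for (@conjC R[i])}).
Implicit Types A B S : H -> H.

Definition bounded_operator A : Prop :=
  linear A /\ exists M : R, forall x, `|A x| <= M%:C * `|x|.

Definition self_adjoint A : Prop :=
  bounded_operator A /\ forall x y, ip (A x) y = ip x (A y).

(* In R[i], [0 <= z] means that z is real and nonnegative. *)
Definition positive_operator A : Prop :=
  self_adjoint A /\ forall x, 0 <= ip x (A x).

Definition op_le A B : Prop :=
  [/\ self_adjoint A, self_adjoint B & positive_operator (B - A)].

Definition is_op_inverse A B : Prop :=
  [/\ bounded_operator B, A \o B = id & B \o A = id].

Definition invertible_operator A : Prop := exists B, is_op_inverse A B.

(* The next two functions return 0 when no inverse, resp. no positive square
   root, exists. *)
Definition op_inv A : H -> H := xget (0 : H -> H) [set B | is_op_inverse A B].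

Definition op_sqrt A : H -> H :=
  xget (0 : H -> H) [set S | positive_operator S /\ S \o S = A].

Definition geometric_mean A B : H -> H :=
  let A12 := op_sqrt A in
  let A12inv := op_inv A12 in
  A12 \o op_sqrt (A12inv \o B \o A12inv) \o A12.

End Operators.

(* Main.v *)
Require Import Defs.
From mathcomp Require Import all_boot all_order all_algebra.
From mathcomp Require Import sesquilinear.
From mathcomp Require Import all_classical all_reals all_analysis.
From mathcomp Require Import complex.
From mathcomp Require Import ring lra.

Set Implicit Arguments.
Unset Strict Implicit.
Unset Printing Implicit Defensive.

Import Order.TTheory GRing.Theory Num.Theory Num.Def.
Import numFieldNormedType.Exports.

Local Open Scope ring_scope.
Local Open Scope complex_scope.

(** Write S for the square root of A and X for the square root of
    S^-1 B S^-1.  Both are positive, A = S S, B = S X X S and A # B = S X S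
    ([geometric_mean_factor]).  The three means are thus congruent, through S,
    to functions of the single operator X: with Y = 1 + X^2, the arithmetic
    mean becomes Y / 2, the geometric one X and the harmonic one 2 X^2 Y^-1.
    The theorem is then a statement about one variable, which follows from
    two expressions of the difference D = 2 X^2 Y^-1 - (r X + (1 - r) Y / 2):

      2 D Y = (1 - X)^4 + (r - 2) (1 - X)^2 Y
            = - (2 X (1 - X)^2 + (1 - r) (1 - X)^2 Y).

    The first has nonnegative terms when 2 <= r, and the bracket of the
    second has nonnegative terms when r <= 1.  To avoid any calculus of
    commuting operators, the inequality is tested on vectors of the form
    S x = Y w: such a w always exists, being read off from the harmonic mean
    at x, and then <Y w, D Y w> is a linear combination of the moments
    <w, X^k w>.  Multiplied by Y once more, the two right-hand sides become,
    up to sign, sums of squares and of values of the positive form of X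
    ([mean_gap_ge0], [mean_gap_le0]).

    The square roots and the inverse behind the harmonic mean have to be
    constructed.  A positive invertible operator A is bounded below by
    Cauchy-Schwarz ([coercive_of_inverse]), hence K = 1 - t A has norm q < 1
    for some t > 0 ([coercive_contraction]).  The inverse of a coercive
    operator is then a Neumann series ([coercive_invertible]), and its square
    root is t^(-1/2) (1 - X) where X is the fixed point of the contraction
    X |-> (K + X^2) / 2 ([quadratic_fixpoint], [positive_sqrt_exists]).  Both
    sequences of operators converge geometrically, so that every property of
    the limit is obtained by letting an error C q^n vanish
    ([le_of_geometric_error]).

    Since self-adjointness and positivity of a complex linear operator can
    be read on the real part of the inner product, all estimates are carried
    out with the real-valued symmetric form [rdot] and the norm [nrm]. *)

(** * Geometric convergence *)

Section RealGeometric.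
Context {R : realType} {q : R}.
Hypotheses (q_ge0 : 0 <= q) (q_lt1 : q < 1).

Lemma geometric_small (C e : R) : 0 < e -> exists n, C * q ^+ n < e.
Proof.
move=> e_gt0; have q_norm : `|q| < 1 by rewrite ger0_norm.
have /cvgrPdist_lt /(_ e e_gt0) [n _ /(_ n (leqnn n))] := cvg_geometric C q_norm.
by rewrite /= sub0r normrN => /(le_lt_trans (ler_norm _)); exists n.
Qed.

(** The way every limit is taken below: a bound with an error [C * q ^+ n],
    valid for all [n], holds without the error. *)
Lemma le_of_geometric_error (a b C : R) :
  (forall n, a <= b + C * q ^+ n) -> a <= b.
Proof.
move=> ab; rewrite leNgt; apply/negP => lt_ba.
have [n] := @geometric_small C (a - b) ltac:(lra).
by have := ab n; lra.
Qed.

End RealGeometric.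

Section RealStructure.
Context {R : realType} {H : completeNormedModType R[i]}.

(** The norm of [H] takes values in [R[i]]; its real part is the norm with
    values in the totally ordered field [R]. *)
Definition nrm (x : H) : R := complex.Re `|x|.

Lemma normE (x : H) : `|x| = (nrm x)%:C.
Proof. by rewrite /nrm RRe_real // normr_real. Qed.

Lemma nrm_ge0 (x : H) : 0 <= nrm x.
Proof. by rewrite -ler0c -normE. Qed.

Lemma nrmD (x y : H) : nrm (x + y) <= nrm x + nrm y.
Proof. by rewrite -lecR rmorphD /= -!normE; exact: ler_normD. Qed.

Lemma nrmBC (x y : H) : nrm (x - y) = nrm (y - x).
Proof. by rewrite /nrm distrC. Qed.

Lemma nrm_chain (x y z : H) : nrm (x - z) <= nrm (x - y) + nrm (y - z).
Proof. by rewrite (le_trans _ (nrmD _ _))// addrA subrK. Qed.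

Lemma nrm0 : nrm (0 : H) = 0.
Proof. by rewrite /nrm normr0. Qed.

Lemma nrmZ (a : R[i]) (x : H) : nrm (a *: x) = complex.Re `|a| * nrm x.
Proof.
have := normrZ a x; rewrite !normE -[`|a|]RRe_real ?normr_real//.
by rewrite -rmorphM => /complexI.
Qed.

Lemma Re_norm_real (a : R) : complex.Re `|a%:C| = `|a|.
Proof. by rewrite normc_def /= expr0n addr0 sqrtr_sqr. Qed.

Lemma nrm_le0 (x : H) : nrm x <= 0 -> x = 0.
Proof.
move=> x_le0; have {x_le0} x0 : nrm x = 0.
  by apply/eqP; rewrite eq_le x_le0 nrm_ge0.
by apply/eqP; rewrite -normr_eq0 normE x0.
Qed.

Lemma eq_of_nrm (x y : H) : nrm (x - y) <= 0 -> x = y.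
Proof. by move=> /nrm_le0/eqP; rewrite subr_eq0 => /eqP. Qed.

(** The distance from [u n] to any later term is a tail of a geometric
    series, so completeness gives a limit, at the distance bounded by the
    whole tail. *)
Lemma geometric_steps_cvg (u : nat -> H) (C q : R) : 0 <= q -> q < 1 ->
  (forall n, nrm (u n.+1 - u n) <= C * q ^+ n) ->
  exists l, forall n, nrm (l - u n) <= C / (1 - q) * q ^+ n.
Proof.
move=> q_ge0 q_lt1 step; set D := C / (1 - q).
have C_ge0 : 0 <= C.
  by have := step 0%N; rewrite expr0 mulr1; apply: le_trans; exact: nrm_ge0.
have CE : C = D * (1 - q) by rewrite /D divfK// gt_eqF// subr_gt0.
have D_ge0 : 0 <= D by rewrite divr_ge0// subr_ge0 ltW.
have dist n k : nrm (u (n + k)%N - u n) <= D * q ^+ n.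
  suff : nrm (u (n + k)%N - u n) <= D * (q ^+ n - q ^+ (n + k)).
    move=> /le_trans; apply; rewrite ler_wpM2l// gerBl; exact: exprn_ge0.
  elim: k => [|k IH]; first by rewrite addn0 !subrr nrm0 mulr0.
  rewrite (le_trans (nrm_chain _ (u (n + k)%N) _))// addnS exprS.
  have := step (n + k)%N; rewrite CE; move: IH; set e := q ^+ (n + k); lra.
have cvgu : cvg (u @ \oo)%classic.
  apply/cauchy_cvgP/cauchy_exP => e e_gt0.
  have eE : e = (complex.Re e)%:C by rewrite RRe_real// gtr0_real.
  have [n small] : exists n, D * q ^+ n < complex.Re e.
    by apply: geometric_small => //; rewrite -ltcR -eE.
  exists (u n); exists n => //= m /= nm.
  rewrite -ball_normE /ball_/= normE eE ltcR nrmBC.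
  by rewrite (le_lt_trans _ small)// -(subnKC nm).
move: cvgu => /cvg_ex[l ul].
exists l => n; apply/ler_addgt0Pr => e e_gt0.
have /cvgrPdist_lt /(_ e%:C) := ul; rewrite ltcR => /(_ e_gt0) [m _ lm].
have := lm (n + m)%N (leq_addl _ _); rewrite /= normE ltcR => /ltW le_e.
by rewrite (le_trans (nrm_chain _ (u (n + m)%N) _))// addrC lerD.
Qed.

Section Linear.
Context {A : H -> H}.
Hypothesis A_lin : linear A.

Lemma linD x y : A (x + y) = A x + A y.
Proof. by have := A_lin 1 x y; rewrite !scale1r. Qed.

Lemma lin0 : A 0 = 0.
Proof. by apply: (addrI (A 0)); rewrite -linD !addr0. Qed.

Lemma linZ a x : A (a *: x) = a *: A x.
Proof. by have := A_lin a x 0; rewrite lin0 !addr0. Qed.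

Lemma linN x : A (- x) = - A x.
Proof. by rewrite -scaleN1r linZ scaleN1r. Qed.

Lemma linB x y : A (x - y) = A x - A y.
Proof. by rewrite linD linN. Qed.

End Linear.

Lemma boundedE (A : H -> H) : bounded_operator A <->
  linear A /\ exists2 M, 0 < M & forall x, nrm (A x) <= M * nrm x.
Proof.
split=> -[A_lin [M]]; last first.
  move=> M_gt0 AM; split=> //; exists M => x.
  by rewrite !normE -rmorphM lecR.
move=> AM; split=> //; exists (`|M| + 1) => [|x].
  by rewrite ltr_wpDl.
have := AM x; rewrite !normE -rmorphM lecR => /le_trans; apply.
rewrite ler_wpM2r ?nrm_ge0//; have := ler_norm M; lra.
Qed.

(** Pointwise limits of linear operators are linear.  The rate is uniform on
    vectors of bounded norm, so the case [n = 0] also bounds [L - X 0]. *)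
Lemma operator_geometric_cvg (X : nat -> H -> H) (C q : R) :
  0 <= q -> q < 1 -> (forall n, linear (X n)) ->
  (forall n x, nrm (X n.+1 x - X n x) <= C * q ^+ n * nrm x) ->
  exists2 L : H -> H, linear L &
    forall n x, nrm (L x - X n x) <= C / (1 - q) * q ^+ n * nrm x.
Proof.
move=> q_ge0 q_lt1 X_lin step.
have /choice[L L_lim] x : exists l, forall n,
    nrm (l - X n x) <= (C * nrm x) / (1 - q) * q ^+ n.
  by apply: geometric_steps_cvg => // n; rewrite mulrAC.
exists L => [a x y|n x]; last first.
  by rewrite (le_trans (L_lim x n))// le_eqVlt; apply/orP; left; apply/eqP; ring.
apply: eq_of_nrm; apply: (@le_of_geometric_error _ q q_ge0 q_lt1 _ _
  (C * nrm (a *: x + y) / (1 - q) + complex.Re `|a| * (C * nrm x / (1 - q)) +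
     C * nrm y / (1 - q))) => n.
have -> : L (a *: x + y) - (a *: L x + L y) =
    (L (a *: x + y) - X n (a *: x + y)) +
    (a *: (X n x - L x) + (X n y - L y)).
  by rewrite X_lin scalerBr [X in _ = _ + X]addrACA -opprD addrA subrK.
rewrite add0r !mulrDl (le_trans (nrmD _ _))// -addrA lerD ?L_lim//.
rewrite (le_trans (nrmD _ _))// lerD//; last by rewrite nrmBC L_lim.
rewrite nrmZ nrmBC -[leRHS]mulrA ler_wpM2l ?L_lim//.
by rewrite -ler0c RRe_real ?normr_real.
Qed.

End RealStructure.

(** * The underlying real inner product *)

Section RealInnerProduct.
Context {R : realType} {H : completeNormedModType R[i]}.
Context (ip : {dot H for (@conjC R[i])}).
Hypothesis ip_norm : induces_norm ip.

Definition rdot (x y : H) : R := complex.Re (ip x y).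

Local Notation "⟨ x , y ⟩" := (rdot x y) (at level 0, x at level 99, y at level 99, format "⟨ x ,  y ⟩").

Lemma ip_conj x y : ip y x = conjc (ip x y).
Proof. by rewrite hermC expr0 mul1r. Qed.

Lemma rdotC x y : ⟨ x, y ⟩ = ⟨ y, x ⟩.
Proof. by rewrite /rdot ip_conj; case: (ip y x). Qed.

Lemma rdotDl x y z : ⟨ x + y, z ⟩ = ⟨ x, z ⟩ + ⟨ y, z ⟩.
Proof. by rewrite /rdot linearDl raddfD. Qed.

Lemma rdotDr x y z : ⟨ x, y + z ⟩ = ⟨ x, y ⟩ + ⟨ x, z ⟩.
Proof. by rewrite !(rdotC x) rdotDl. Qed.

Lemma rdot0r x : ⟨x, 0⟩ = 0.
Proof. by rewrite /rdot linear0r. Qed.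

Lemma rdotZl (a : R) x y : ⟨ a%:C *: x, y ⟩ = a * ⟨ x, y ⟩.
Proof.
by rewrite /rdot linearZl_LR /=; case: (ip x y) => u v /=; rewrite mul0r subr0.
Qed.

Lemma rdotZr (a : R) x y : ⟨ x, a%:C *: y ⟩ = a * ⟨ x, y ⟩.
Proof. by rewrite !(rdotC x) rdotZl. Qed.

Lemma rdotNl x y : ⟨ - x, y ⟩ = - ⟨ x, y ⟩.
Proof. by rewrite /rdot linearNl raddfN. Qed.

Lemma rdotNr x y : ⟨ x, - y ⟩ = - ⟨ x, y ⟩.
Proof. by rewrite !(rdotC x) rdotNl. Qed.

Lemma rdotBl x y z : ⟨ x - y, z ⟩ = ⟨ x, z ⟩ - ⟨ y, z ⟩.
Proof. by rewrite rdotDl rdotNl. Qed.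

Lemma rdotBr x y z : ⟨ x, y - z ⟩ = ⟨ x, y ⟩ - ⟨ x, z ⟩.
Proof. by rewrite rdotDr rdotNr. Qed.

Lemma rdotxx x : ⟨ x, x ⟩ = nrm x ^+ 2.
Proof. by rewrite /rdot -ip_norm normE -rmorphXn. Qed.

Lemma Im_ip x y : complex.Im (ip x y) = - ⟨ 'i *: x, y ⟩.
Proof.
rewrite /rdot linearZl_LR /=; case: (ip x y) => u v /=.
by rewrite mul0r mul1r sub0r opprK.
Qed.

(** The imaginary part of [ip x y] is, up to sign, the real part at
    ['i *: x], so for a complex linear operator symmetry of the real part is enough. *)
Lemma self_adjoint_of_rdot (A : H -> H) : bounded_operator A ->
  (forall x y, ⟨ A x, y ⟩ = ⟨ x, A y ⟩) -> self_adjoint ip A.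
Proof.
move=> A_bd A_sym; split=> // x y.
apply/eqP; rewrite eq_complex -!/(rdot _ _) A_sym eqxx /=.
by rewrite !Im_ip -(linZ A_bd.1) A_sym.
Qed.

Lemma rdot_sym (A : H -> H) : self_adjoint ip A ->
  forall x y, ⟨ A x, y ⟩ = ⟨ x, A y ⟩.
Proof. by move=> [_ A_sym] x y; rewrite /rdot A_sym. Qed.

Lemma positive_of_rdot (A : H -> H) : self_adjoint ip A ->
  (forall x, 0 <= ⟨ x, A x ⟩) -> positive_operator ip A.
Proof.
move=> A_sa A_ge0; split=> // x; rewrite lecE; apply/andP; split; last exact: A_ge0.
have := ip_conj x (A x); rewrite A_sa.2; case: (ip x (A x)) => u v [] /=.
by move=> h; apply/eqP; lra.
Qed.

Lemma rdot_ge0 (A : H -> H) : positive_operator ip A ->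
  forall x, 0 <= ⟨ x, A x ⟩.
Proof. by move=> [_ A_ge0] x; have := A_ge0 x; rewrite lecE => /andP[]. Qed.

Lemma id_positive : positive_operator ip id.
Proof.
apply: positive_of_rdot => [|x]; last by rewrite rdotxx sqr_ge0.
split=> //; split=> //; exists 1 => x; by rewrite mul1r.
Qed.

(** The polynomial <x + t y, A (x + t y)> in the real variable t is
    nonnegative, so its discriminant is nonpositive. *)
Lemma Cauchy_Schwarz (A : H -> H) : positive_operator ip A ->
  forall x y, ⟨ x, A y ⟩ ^+ 2 <= ⟨ x, A x ⟩ * ⟨ y, A y ⟩.
Proof.
move=> A_pos x y.
set a := ⟨ x, A x ⟩; set b := ⟨ x, A y ⟩; set c := ⟨ y, A y ⟩.
have quad t : 0 <= a + 2 * t * b + t ^+ 2 * c.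
  have A_lin := A_pos.1.1.1.
  have := rdot_ge0 A_pos (x + t%:C *: y).
  rewrite (linD A_lin) (linZ A_lin) !rdotDl !rdotDr !rdotZl !rdotZr.
  by rewrite -(rdot_sym A_pos.1 y x) (rdotC (A y)) -/a -/b -/c; lra.
have [c0|c_neq0] := eqVneq c 0.
  have [b0|b_neq0] := eqVneq b 0; first by rewrite b0 c0 mulr0 expr0n.
  (* The quadratic is affine, and takes the value -1 at this point. *)
  have := quad (- (a + 1) / (2 * b)); rewrite c0.
  have -> : a + 2 * (- (a + 1) / (2 * b)) * b + (- (a + 1) / (2 * b)) ^+ 2 * 0 = -1.
    by field.
  by lra.
have c_gt0 : 0 < c by rewrite lt_neqAle eq_sym c_neq0 (rdot_ge0 A_pos).
have := quad (- b / c).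
have -> : a + 2 * (- b / c) * b + (- b / c) ^+ 2 * c = (a * c - b ^+ 2) / c.
  by field.
by rewrite pmulr_lge0 ?invr_gt0// subr_ge0.
Qed.

Lemma rdot_le x y : `|⟨ x, y ⟩| <= nrm x * nrm y.
Proof.
rewrite -ler_sqr ?nnegrE ?mulr_ge0 ?nrm_ge0// real_normK ?num_real//.
by rewrite exprMn -!rdotxx; exact: (Cauchy_Schwarz id_positive).
Qed.

Lemma boundedD (A B : H -> H) : bounded_operator A -> bounded_operator B ->
  bounded_operator (A + B).
Proof.
move=> [A_lin [M AM]] [B_lin [N BN]]; split=> [a x y|].
  by rewrite !fctE A_lin B_lin scalerDr addrACA.
exists (M + N) => x; rewrite fctE rmorphD mulrDl.
by rewrite (le_trans (ler_normD _ _))// lerD.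
Qed.

Lemma boundedZ (a : R) (A : H -> H) : bounded_operator A ->
  bounded_operator (a%:C *: A).
Proof.
move=> /boundedE[A_lin [M M_gt0 AM]]; apply/boundedE; split=> [b x y|].
  by rewrite !fctE A_lin scalerDr !scalerA mulrC.
exists ((`|a| + 1) * M) => [|x]; first by rewrite mulr_gt0// ltr_wpDl.
rewrite fctE nrmZ Re_norm_real -mulrA ler_pM ?nrm_ge0//; lra.
Qed.

Lemma bounded_comp (A B : H -> H) : bounded_operator A -> bounded_operator B ->
  bounded_operator (A \o B).
Proof.
move=> /boundedE[A_lin [M M_gt0 AM]] /boundedE[B_lin [N N_gt0 BN]].
apply/boundedE; split=> [a x y|]; first by rewrite /= B_lin A_lin.
exists (M * N) => [|x]; first exact: mulr_gt0.
by rewrite /= (le_trans (AM _))// -mulrA ler_wpM2l// ltW.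
Qed.

Lemma self_adjointD (A B : H -> H) : self_adjoint ip A -> self_adjoint ip B ->
  self_adjoint ip (A + B).
Proof.
move=> A_sa B_sa; apply: self_adjoint_of_rdot.
  exact: (boundedD A_sa.1 B_sa.1).
by move=> x y; rewrite !fctE rdotDl rdotDr !rdot_sym.
Qed.

Lemma self_adjointZ (a : R) (A : H -> H) : self_adjoint ip A ->
  self_adjoint ip (a%:C *: A).
Proof.
move=> A_sa; apply: self_adjoint_of_rdot; first exact: (boundedZ _ A_sa.1).
by move=> x y; rewrite !fctE rdotZl rdotZr !rdot_sym.
Qed.

Lemma self_adjointB (A B : H -> H) : self_adjoint ip A -> self_adjoint ip B ->
  self_adjoint ip (A - B).
Proof.
move=> A_sa B_sa; rewrite -scaleN1r.
have -> : -1 = (-1)%:C :> R[i] by rewrite rmorphN1.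
by apply: self_adjointD => //; apply: self_adjointZ.
Qed.

Lemma positiveD (A B : H -> H) : positive_operator ip A ->
  positive_operator ip B -> positive_operator ip (A + B).
Proof.
move=> A_pos B_pos; apply: positive_of_rdot.
  exact: (self_adjointD A_pos.1 B_pos.1).
by move=> x; rewrite fctE rdotDr addr_ge0// rdot_ge0.
Qed.

Lemma positiveZ (a : R) (A : H -> H) : 0 <= a -> positive_operator ip A ->
  positive_operator ip (a%:C *: A).
Proof.
move=> a_ge0 A_pos; apply: positive_of_rdot; first exact: (self_adjointZ _ A_pos.1).
by move=> x; rewrite fctE rdotZr mulr_ge0// rdot_ge0.
Qed.

Lemma positive_congruence (S A : H -> H) : self_adjoint ip S ->
  positive_operator ip A -> positive_operator ip (S \o A \o S).
Proof.
move=> S_sa A_pos; apply: positive_of_rdot => [|x]; last first.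
  by rewrite /= -rdot_sym// rdot_ge0.
apply: self_adjoint_of_rdot => [|x y]; last by rewrite /= !rdot_sym//; exact: A_pos.1.
by apply: bounded_comp S_sa.1; apply: bounded_comp S_sa.1 A_pos.1.1.
Qed.

End RealInnerProduct.

(** * Inverses and square roots of positive operators *)

Section PositiveInvertible.
Context {R : realType} {H : completeNormedModType R[i]}.
Context {ip : {dot H for (@conjC R[i])}}.
Hypothesis ip_norm : induces_norm ip.

Local Notation "⟨ x , y ⟩" := (rdot ip x y)
  (at level 0, x at level 99, y at level 99, format "⟨ x ,  y ⟩").

Definition coercive (A : H -> H) (c : R) : Prop :=
  forall x, c * nrm x ^+ 2 <= ⟨x, A x⟩.

Lemma is_op_inverseK (A B : H -> H) : is_op_inverse A B -> cancel B A.
Proof. by move=> [_ AB _] x; have := congr1 (@^~ x) AB. Qed.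

Lemma is_op_inverseC (A B : H -> H) : bounded_operator A ->
  is_op_inverse A B -> is_op_inverse B A.
Proof. by move=> A_bd [B_bd AB BA]. Qed.

(** If x = A (B x), then <x, B x> = <B x, A (B x)>. *)
Lemma op_inverse_positive (A B : H -> H) : positive_operator ip A ->
  is_op_inverse A B -> positive_operator ip B.
Proof.
move=> A_pos AB; have BK := is_op_inverseK AB.
have B_sym x y : ⟨B x, y⟩ = ⟨x, B y⟩.
  by rewrite -{1}(BK y) -(rdot_sym A_pos.1) BK.
apply: positive_of_rdot => [|x].
  by apply: self_adjoint_of_rdot => //; case: AB.
by rewrite -{1}(BK x) (rdot_sym A_pos.1) (rdot_ge0 A_pos).
Qed.

(** Cauchy-Schwarz for the form of A, at x and B x, reads
    |x|^4 <= <x, A x> <B x, x>, and the last factor is at most a multiple of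
    |x|^2. *)
Lemma coercive_of_inverse (A B : H -> H) : positive_operator ip A ->
  is_op_inverse A B -> exists2 c, 0 < c & coercive A c.
Proof.
move=> A_pos AB; have BK := is_op_inverseK AB.
have [B_lin [M M_gt0 BM]] : linear B /\
    exists2 M, 0 < M & forall x, nrm (B x) <= M * nrm x.
  by apply/boundedE; case: AB.
exists M^-1 => [|x]; first by rewrite invr_gt0.
have [->|x_neq0] := eqVneq x 0.
  by rewrite nrm0 expr0n mulr0 (lin0 A_pos.1.1.1) rdotxx// nrm0 expr0n.
have x_gt0 : 0 < nrm x.
  rewrite lt_neqAle nrm_ge0 andbT eq_sym; apply: contraNN x_neq0 => /eqP x0.
  by apply/eqP; apply: nrm_le0; rewrite x0.
have := Cauchy_Schwarz A_pos x (B x); rewrite BK rdotxx// => CS.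
have Bx_le : ⟨B x, x⟩ <= M * nrm x ^+ 2.
  rewrite (le_trans (ler_norm _))// (le_trans (rdot_le _ _ _))//.
  by rewrite expr2 mulrA ler_wpM2r ?nrm_ge0.
rewrite mulrC ler_pdivrMr// -(ler_pM2r (exprn_gt0 2 x_gt0)) -expr2.
rewrite (le_trans CS)// -mulrA ler_wpM2l//; exact: rdot_ge0.
Qed.

(** For t = 1 / (M + c), with M a bound for A, the form of K = 1 - t A lies
    between 0 and q = 1 - c t.  Cauchy-Schwarz for that form, at K x and x,
    turns this bound on the form into the bound q on the norm. *)
Lemma coercive_contraction (A : H -> H) (c : R) : positive_operator ip A ->
  0 < c -> coercive A c -> exists t q, [/\ 0 < t, 0 <= q, q < 1,
    self_adjoint ip (id - t%:C *: A) &
    forall x, nrm (x - t%:C *: A x) <= q * nrm x].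
Proof.
move=> A_pos c_gt0 A_c.
have [A_lin [M M_gt0 AM]] := (@boundedE _ _ A).1 A_pos.1.1.
have t_gt0 : 0 < (M + c)^-1 by rewrite invr_gt0 addr_gt0.
(* Adding c to the bound of A makes q nonnegative. *)
exists (M + c)^-1, (1 - c / (M + c)).
have q_ge0 : 0 <= 1 - c / (M + c).
  by rewrite subr_ge0 ler_pdivrMr ?addr_gt0//; lra.
set t := (M + c)^-1 in t_gt0 *; set q := 1 - c * t in q_ge0 *.
pose K : H -> H := id - t%:C *: A.
have KE x : K x = x - t%:C *: A x by [].
have K_sa : self_adjoint ip K.
  exact: self_adjointB (id_positive ip_norm).1 (self_adjointZ _ A_pos.1).
have K_pos : positive_operator ip K.
  apply: positive_of_rdot => // x; rewrite KE rdotBr rdotZr rdotxx//.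
  rewrite subr_ge0 /t mulrC ler_pdivrMr ?addr_gt0//.
  rewrite (le_trans (ler_norm _))// (le_trans (rdot_le ip_norm _ _))//.
  rewrite expr2 -mulrA ler_wpM2l ?nrm_ge0// (le_trans (AM x))// mulrC.
  by rewrite ler_wpM2l ?nrm_ge0//; lra.
have K_le x : ⟨x, K x⟩ <= q * nrm x ^+ 2.
  rewrite KE rdotBr rdotZr rdotxx// /q mulrBl mul1r lerD2l lerN2.
  by rewrite mulrAC [leLHS]mulrC mulrC (mulrC (_ * _)) ler_wpM2l// ltW.
split=> //; first by rewrite /q; have := mulr_gt0 c_gt0 t_gt0; lra.
move=> x; rewrite -KE -ler_sqr ?nnegrE ?mulr_ge0 ?nrm_ge0// exprMn.
have := Cauchy_Schwarz K_pos (K x) x; rewrite rdotxx// => CS.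
have {}CS : (nrm (K x) ^+ 2) ^+ 2 <= (q * nrm (K x) ^+ 2) * (q * nrm x ^+ 2).
  by rewrite (le_trans CS)// ler_pM ?K_le ?rdot_ge0.
have [->|Kx_neq0] := eqVneq (nrm (K x) ^+ 2) 0.
  by rewrite mulr_ge0// sqr_ge0.
have Kx_gt0 : 0 < nrm (K x) ^+ 2 by rewrite lt_neqAle eq_sym Kx_neq0 sqr_ge0.
by rewrite -(ler_pM2l Kx_gt0) -expr2 (le_trans CS)// le_eqVlt; apply/orP; left;
  apply/eqP; ring.
Qed.

(** The partial sums of the Neumann series of t (1 - K)^-1, where
    K = 1 - t A, converge to a right inverse of A; coercivity makes A
    injective, so it is an inverse on both sides. *)
Lemma coercive_invertible (A : H -> H) (c : R) : positive_operator ip A ->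
  0 < c -> coercive A c -> invertible_operator A.
Proof.
move=> A_pos c_gt0 A_c; have A_lin := A_pos.1.1.1.
have [t [q [t_gt0 q_ge0 q_lt1 [[K_lin _] _] K_q]]] :=
  coercive_contraction A_pos c_gt0 A_c.
set K : H -> H := id - t%:C *: A in K_lin.
have {}K_q x : nrm (K x) <= q * nrm x by exact: K_q.
pose U := fix U n : H -> H :=
  if n is m.+1 then fun x => K (U m x) + t%:C *: x else fun=> 0.
have U_lin n : linear (U n).
  elim: n => [|n IH] a x y /=; first by rewrite scaler0 addr0.
  rewrite IH K_lin !scalerDr !scalerA addrACA.
  by rewrite (mulrC t%:C).
have U_step n x : nrm (U n.+1 x - U n x) <= t * q ^+ n * nrm x.
  elim: n => [|n IH] /=.
    rewrite (lin0 K_lin) add0r subr0 nrmZ Re_norm_real expr0 mulr1.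
    by rewrite gtr0_norm.
  rewrite opprD addrACA subrr addr0 -(linB K_lin) (le_trans (K_q _))//.
  by rewrite exprS mulrCA -mulrA ler_wpM2l.
have [B B_lin B_lim] := operator_geometric_cvg q_ge0 q_lt1 U_lin U_step.
set D := t / (1 - q) in B_lim.
have B_fix x : B x = K (B x) + t%:C *: x.
  apply: eq_of_nrm; apply: (@le_of_geometric_error _ q q_ge0 q_lt1 _ _
    (D * q * nrm x + q * D * nrm x)) => n.
  rewrite add0r (le_trans (nrm_chain _ (U n.+1 x) _))// mulrDl lerD//.
    by rewrite (le_trans (B_lim _ _))// exprS !mulrA mulrAC.
  rewrite /= opprD addrACA subrr addr0 nrmBC -(linB K_lin) (le_trans (K_q _))//.
  have -> : q * D * nrm x * q ^+ n = q * (D * q ^+ n * nrm x) by ring.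
  by rewrite ler_wpM2l.
have BK x : A (B x) = x.
  have /eqP : t%:C *: (x - A (B x)) = 0.
    apply: (addrI (B x)); rewrite addr0 [RHS]B_fix /K !fctE.
    by rewrite scalerBr [t%:C *: x - _]addrC addrA.
  rewrite scaler_eq0 eq_complex /= eqxx andbT gt_eqF//= subr_eq0.
  by move=> /eqP.
have A_inj x : A x = 0 -> x = 0.
  move=> Ax0; have := A_c x; rewrite Ax0 rdot0r.
  rewrite pmulr_rle0// => x2_le0; apply: nrm_le0.
  have : nrm x ^+ 2 == 0 by rewrite eq_le x2_le0 sqr_ge0.
  by rewrite sqrf_eq0 => /eqP ->.
exists B; split.
- apply/boundedE; split=> //; exists D => [|x].
    by rewrite divr_gt0// subr_gt0.
  by have := B_lim 0%N x; rewrite subr0 expr0 mulr1.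
- by apply/funext => x /=; rewrite BK.
- apply/funext => x /=; apply/eqP; rewrite -subr_eq0; apply/eqP/A_inj.
  by rewrite (linB A_lin) BK subrr.
Qed.

(** The iterates of X |-> (K + X^2) / 2 from 0 stay in the ball of radius q,
    on which this map is q-Lipschitz, because
    X^2 - Y^2 = X (X - Y) + (X - Y) Y. *)
Lemma quadratic_fixpoint (K : H -> H) (q : R) : 0 <= q -> q < 1 ->
  self_adjoint ip K -> (forall x, nrm (K x) <= q * nrm x) ->
  exists X : H -> H, [/\ self_adjoint ip X,
    forall x, nrm (X x) <= q * nrm x &
    forall x, X x = (2^-1)%:C *: (K x + X (X x))].
Proof.
move=> q_ge0 q_lt1 K_sa K_q; have K_lin := K_sa.1.1.
pose U := fix U n : H -> H :=
  if n is m.+1 then fun x => (2^-1)%:C *: (K x + U m (U m x)) else fun=> 0.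
have half : `|2^-1 : R| = 2^-1 by rewrite ger0_norm// invr_ge0.
have U_lin n : linear (U n).
  elim: n => [|n IH] a x y /=; first by rewrite scaler0 addr0.
  by rewrite !IH K_lin addrACA -scalerDr [LHS]scalerDr !scalerA (mulrC a).
have U_q n x : nrm (U n x) <= q * nrm x.
  elim: n x => [|n IH] x /=; first by rewrite nrm0 mulr_ge0 ?nrm_ge0.
  rewrite nrmZ Re_norm_real half.
  have := nrmD (K x) (U n (U n x)).
  have := K_q x; have := IH (U n x).
  have : q * nrm (U n x) <= nrm (U n x).
    by rewrite ler_piMl ?nrm_ge0// ltW.
  by have := IH x; lra.
have U_sym n x y : ⟨U n x, y⟩ = ⟨x, U n y⟩.
  elim: n x y => [|n IH] x y /=.
    by rewrite rdotC !rdot0r.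
  by rewrite rdotZl rdotZr rdotDl rdotDr !IH (rdot_sym K_sa).
have U_step n x : nrm (U n.+1 x - U n x) <= 1 * q ^+ n * nrm x.
  elim: n x => [|n IH] x.
    rewrite /= addr0 subr0 nrmZ Re_norm_real half expr0 !mul1r.
    have := K_q x; have := nrm_ge0 x.
    have : q * nrm x <= nrm x by rewrite ler_piMl ?nrm_ge0// ltW.
    by lra.
  have -> : U n.+2 x - U n.+1 x = (2^-1)%:C *: (U n.+1 (U n.+1 x - U n x) +
      (U n.+1 (U n x) - U n (U n x))).
    rewrite [U n.+2]/= [in X in _ - X]/= -scalerBr; congr (_ *: _).
    by rewrite (linB (U_lin n.+1)) addrA subrK opprD addrACA subrr add0r.
  rewrite nrmZ Re_norm_real half.
  have := nrmD (U n.+1 (U n.+1 x - U n x)) (U n.+1 (U n x) - U n (U n x)).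
  have : nrm (U n.+1 (U n.+1 x - U n x)) <= q * (1 * q ^+ n * nrm x).
    by rewrite (le_trans (U_q _ _))// ler_wpM2l.
  have : nrm (U n.+1 (U n x) - U n (U n x)) <= 1 * q ^+ n * (q * nrm x).
    rewrite (le_trans (IH _))// ler_wpM2l// mul1r; exact: exprn_ge0.
  by rewrite exprS; lra.
have [X X_lin X_lim] := operator_geometric_cvg q_ge0 q_lt1 U_lin U_step.
set D := 1 / (1 - q) in X_lim.
have X_q x : nrm (X x) <= q * nrm x.
  apply: (@le_of_geometric_error _ q q_ge0 q_lt1 _ _ (D * nrm x)) => n.
  have := nrmD (X x - U n x) (U n x); rewrite subrK.
  by have := U_q n x; have := X_lim n x; lra.
exists X; split=> //.
- apply: self_adjoint_of_rdot => [|x y].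
    apply/boundedE; split=> //; exists 1 => // x.
    by rewrite (le_trans (X_q x))// ler_wpM2r ?nrm_ge0// ltW.
  apply/eqP; rewrite -subr_eq0 -normr_eq0 eq_le normr_ge0 andbT.
  apply: (@le_of_geometric_error _ q q_ge0 q_lt1 _ _
    (D * nrm x * nrm y + nrm x * (D * nrm y))) => n.
  have -> : ⟨X x, y⟩ - ⟨x, X y⟩ = ⟨X x - U n x, y⟩ - ⟨x, X y - U n y⟩.
    by rewrite rdotBl rdotBr U_sym; lra.
  rewrite add0r (le_trans (ler_normB _ _))// mulrDl lerD//.
    rewrite (le_trans (rdot_le ip_norm _ _))//.
    by rewrite mulrAC ler_wpM2r ?nrm_ge0// mulrAC.
  rewrite (le_trans (rdot_le ip_norm _ _))//.
  by rewrite -mulrA ler_wpM2l ?nrm_ge0// mulrAC.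
- move=> x; apply: eq_of_nrm; apply: (@le_of_geometric_error _ q q_ge0 q_lt1 _ _
    (D * q * nrm x + 2^-1 * (q * (D * nrm x) + D * nrm (X x)))) => n.
  rewrite add0r (le_trans (nrm_chain _ (U n.+1 x) _))// mulrDl lerD//.
    by rewrite (le_trans (X_lim _ _))// exprS !mulrA mulrAC.
  rewrite /= -scalerBr opprD addrACA subrr add0r nrmZ Re_norm_real half.
  rewrite -[leRHS]mulrA ler_wpM2l ?invr_ge0// mulrDl.
  rewrite (le_trans (nrm_chain _ (U n (X x)) _))// lerD//.
    rewrite -(linB (U_lin n)).
    by rewrite (le_trans (U_q _ _))// -mulrA ler_wpM2l// nrmBC mulrAC.
  by rewrite nrmBC mulrAC.
Qed.

(** If 2 X = K + X^2 with K = 1 - t A, then (1 - X)^2 = t A. *)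
Lemma positive_sqrt_exists (A : H -> H) : positive_operator ip A ->
  invertible_operator A ->
  positive_operator ip (op_sqrt ip A) /\ op_sqrt ip A \o op_sqrt ip A = A.
Proof.
move=> A_pos [B AB].
suff [S SA] : exists S, positive_operator ip S /\ S \o S = A.
  rewrite /op_sqrt; by case: xgetP => [? _|/(_ S)].
have [c c_gt0 A_c] := coercive_of_inverse A_pos AB.
have [t [q [t_gt0 q_ge0 q_lt1 K_sa K_q]]] :=
  coercive_contraction A_pos c_gt0 A_c.
have [X [X_sa X_q XE]] := quadratic_fixpoint q_ge0 q_lt1 K_sa K_q.
have X_lin := X_sa.1.1.
exists ((Num.sqrt t^-1)%:C *: (id - X)); split.
  apply: positiveZ; first exact: sqrtr_ge0.
  apply: positive_of_rdot => [|x].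
    exact: self_adjointB (id_positive ip_norm).1 X_sa.
  rewrite !fctE rdotBr subr_ge0 rdotxx// (le_trans (ler_norm _))//.
  rewrite (le_trans (rdot_le ip_norm _ _))// expr2 ler_wpM2l ?nrm_ge0//.
  by rewrite (le_trans (X_q x))// ler_piMl ?nrm_ge0// ltW.
have X2 x : X x + X x = (x - t%:C *: A x) + X (X x).
  set z := RHS; have -> : X x = (2^-1)%:C *: z by exact: XE.
  rewrite -scalerDl -rmorphD (_ : 2^-1 + 2^-1 = 1) ?scale1r//.
  by field.
apply/funext => x; rewrite /= !fctE.
rewrite (linZ X_lin) -scalerBr scalerA -rmorphM -expr2.
rewrite sqr_sqrtr ?invr_ge0 ?(ltW t_gt0)// (linB X_lin).
have -> : x - X x - (X x - X (X x)) = t%:C *: A x.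
  rewrite opprB addrACA -opprD X2 opprD opprB addrACA subrr addr0.
  by rewrite addrC subrK.
by rewrite scalerA -rmorphM mulVf ?gt_eqF// scale1r.
Qed.

End PositiveInvertible.

(** * The inequality between the means *)

Section Means.
Context {R : realType} {H : completeNormedModType R[i]}.
Context {ip : {dot H for (@conjC R[i])}}.
Hypothesis ip_norm : induces_norm ip.

Local Notation "⟨ x , y ⟩" := (rdot ip x y)
  (at level 0, x at level 99, y at level 99, format "⟨ x ,  y ⟩").

(** For a vector z = Y w with Y = 1 + X^2, this is the quadratic form at z of
    2 X^2 Y^-1 - (r X + (1 - r) Y / 2), the harmonic mean of 1 and X^2 minus
    the combination of their geometric and arithmetic means; substituting
    Y w for z removes the inverse. *)
Definition mean_gap (X : H -> H) (r : R) (w : H) : R :=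
  let z := w + X (X w) in
  ⟨z, X (X w) + X (X w)⟩ -
    (r * ⟨z, X z⟩ + (1 - r) * (2^-1 * (⟨z, z⟩ + ⟨X z, X z⟩))).

Lemma half_twice (x : H) : (2^-1)%:C *: x + (2^-1)%:C *: x = x.
Proof.
by rewrite -scalerDl -rmorphD (_ : 2^-1 + 2^-1 = 1) ?scale1r//; field.
Qed.

Section Gap.
Context {X : H -> H}.
Hypothesis X_pos : positive_operator ip X.

Lemma mean_gap_ge0 r w : 2 <= r -> 0 <= mean_gap X r w.
Proof.
move=> r_ge2; have X_lin := X_pos.1.1.1.
(* p = (1 - X)^2 w and s = (1 - X) Y w, with Y = 1 + X^2. *)
pose p := w - (X w + X w) + X (X w).
pose s := (w + X (X w)) - X (w + X (X w)).
suff -> : mean_gap X r w =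
    2^-1 * (⟨p, p⟩ + ⟨X p, X p⟩) + (r - 2) * 2^-1 * ⟨s, s⟩.
  have sq_ge0 v : 0 <= ⟨v, v⟩ by rewrite rdotxx// sqr_ge0.
  have := mulr_ge0 (_ : 0 <= r - 2) (sq_ge0 s); rewrite subr_ge0.
  by move=> /(_ r_ge2); have := sq_ge0 p; have := sq_ge0 (X p); lra.
rewrite /mean_gap /p /s !(linD X_lin, linN X_lin).
(* Symmetry of X brings every term to a moment <w, X^k w>. *)
rewrite !(rdotDl, rdotNl, rdotDr, rdotNr) !(rdot_sym X_pos.1).
by field.
Qed.

Lemma mean_gap_le0 r w : r <= 1 -> mean_gap X r w <= 0.
Proof.
move=> r_le1; have X_lin := X_pos.1.1.1.
(* d = (1 - X) w and s = (1 - X) Y w, with Y = 1 + X^2. *)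
pose d := w - X w.
pose s := (w + X (X w)) - X (w + X (X w)).
suff -> : mean_gap X r w =
    - (⟨d, X d⟩ + ⟨X d, X (X d)⟩ + (1 - r) * 2^-1 * ⟨s, s⟩).
  have := mulr_ge0 (_ : 0 <= 1 - r) (_ : 0 <= ⟨s, s⟩).
  rewrite subr_ge0 {1}rdotxx// => /(_ r_le1 (sqr_ge0 _)).
  by have := rdot_ge0 X_pos d; have := rdot_ge0 X_pos (X d); lra.
rewrite /mean_gap /d /s !(linD X_lin, linN X_lin).
(* Symmetry of X brings every term to a moment <w, X^k w>. *)
rewrite !(rdotDl, rdotNl, rdotDr, rdotNr) !(rdot_sym X_pos.1).
by field.
Qed.

End Gap.

Lemma op_invP (A : H -> H) : invertible_operator A -> is_op_inverse A (op_inv A).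
Proof. by move=> [B AB]; rewrite /op_inv; case: xgetP => [? _|/(_ B)]. Qed.

Lemma half_real : 2^-1 = (2^-1)%:C :> R[i].
Proof. by rewrite fmorphV rmorph_nat. Qed.

(** The inverse of S is S A^-1; it is a left inverse because S commutes with
    A = S S, hence with A^-1. *)
Lemma op_sqrt_invertible (A : H -> H) : positive_operator ip A ->
  invertible_operator A -> invertible_operator (op_sqrt ip A).
Proof.
move=> A_pos A_inv; have AB := op_invP A_inv.
have [S_pos /(congr1 (@^~ _)) SS] := positive_sqrt_exists ip_norm A_pos A_inv.
set S := op_sqrt ip A in S_pos SS *; set B := op_inv A in AB *.
have {}SS x : S (S x) = A x by exact: SS.
have BK := is_op_inverseK AB.
have AK := is_op_inverseK (is_op_inverseC A_pos.1.1 AB).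
exists (S \o B); split.
- by apply: bounded_comp S_pos.1.1 _; case: AB.
- by apply/funext => x /=; rewrite SS BK.
- (* S (B (S x)) = S (B (S (A (B x)))), and S commutes with A. *)
  by apply/funext => x /=; rewrite -{1}(BK x) -SS SS AK SS BK.
Qed.

(** A simultaneous reduction of A and B, by congruence through S, to the
    commuting operators 1 and X^2. *)
Lemma geometric_mean_factor (A B : H -> H) :
  positive_operator ip A -> invertible_operator A ->
  positive_operator ip B -> invertible_operator B ->
  exists S X, [/\ positive_operator ip S /\ invertible_operator S,
    positive_operator ip X,
    A = S \o S, B = S \o (X \o X) \o S &
    geometric_mean ip A B = S \o X \o S].
Proof.
move=> A_pos A_inv B_pos B_inv.
have [S_pos SS] := positive_sqrt_exists ip_norm A_pos A_inv.
have S_inv := op_sqrt_invertible A_pos A_inv.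
rewrite /geometric_mean; set S := op_sqrt ip A in S_pos SS S_inv *.
have SS' := op_invP S_inv; set S' := op_inv S in SS' *.
have S'_pos := op_inverse_positive S_pos SS'.
have S'K := is_op_inverseK SS'.
have SK := is_op_inverseK (is_op_inverseC S_pos.1.1 SS').
have T_pos := positive_congruence S'_pos.1 B_pos.
have T_inv : invertible_operator (S' \o B \o S').
  have BB' := op_invP B_inv; have B'K := is_op_inverseK BB'.
  have BK := is_op_inverseK (is_op_inverseC B_pos.1.1 BB').
  have B'_pos := op_inverse_positive B_pos BB'.
  exists (S \o op_inv B \o S); split.
  - by have [[]] := positive_congruence S_pos.1 B'_pos.
  - by apply/funext => x /=; rewrite SK B'K SK.
  - by apply/funext => x /=; rewrite S'K BK S'K.
have [X_pos XX] := positive_sqrt_exists ip_norm T_pos T_inv.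
exists S, (op_sqrt ip (S' \o B \o S')); split=> //.
by rewrite XX; apply/funext => x /=; rewrite S'K SK.
Qed.

(** The inverse of A is itself positive and invertible, hence coercive, and
    adding the positive inverse of B keeps it so. *)
Lemma harmonic_mean_invertible (A B : H -> H) :
  positive_operator ip A -> invertible_operator A ->
  positive_operator ip B -> invertible_operator B ->
  positive_operator ip ((2^-1)%:C *: (op_inv A + op_inv B)) /\
  invertible_operator ((2^-1)%:C *: (op_inv A + op_inv B)).
Proof.
move=> A_pos /op_invP AA' B_pos /op_invP BB'.
have A'_pos := op_inverse_positive A_pos AA'.
have B'_pos := op_inverse_positive B_pos BB'.
have P_pos : positive_operator ip ((2^-1)%:C *: (op_inv A + op_inv B)).
  by apply: positiveZ; rewrite ?invr_ge0//; apply: positiveD.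
split=> //.
have [c c_gt0 A'_c] :=
  coercive_of_inverse ip_norm A'_pos (is_op_inverseC A_pos.1.1 AA').
apply: (@coercive_invertible _ _ _ ip_norm _ (2^-1 * c)) => // [|x].
  by rewrite mulr_gt0// invr_gt0.
rewrite !fctE rdotZr rdotDr -mulrA ler_wpM2l ?invr_ge0//.
by rewrite (le_trans (A'_c x))// lerDl (rdot_ge0 B'_pos).
Qed.

(** Let u be the harmonic mean at x, so that x = (A^-1 u + B^-1 u) / 2, and
    take w = S (B^-1 u) / 2.  Since S (A^-1 u) = X^2 S (B^-1 u), this gives
    S x = w + X^2 w and u = S (2 X^2 w). *)
Lemma mean_gap_form (A B : H -> H) :
  positive_operator ip A -> invertible_operator A ->
  positive_operator ip B -> invertible_operator B ->
  exists2 X, positive_operator ip X & forall r x, exists w,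
    ⟨x, op_inv ((2^-1)%:C *: (op_inv A + op_inv B)) x⟩ -
    ⟨x, (r%:C *: geometric_mean ip A B +
         (1 - r)%:C *: ((2^-1)%:C *: (A + B))) x⟩ = mean_gap X r w.
Proof.
move=> A_pos A_inv B_pos B_inv.
have [_ P_inv] := harmonic_mean_invertible A_pos A_inv B_pos B_inv.
have [S [X [[S_pos S_inv] X_pos AE BE ->]]] :=
  geometric_mean_factor A_pos A_inv B_pos B_inv.
have Av v : A v = S (S v) by rewrite {1}AE.
have Bv v : B v = S (X (X (S v))) by rewrite {1}BE.
have PK := is_op_inverseK (op_invP P_inv).
have A'K := is_op_inverseK (op_invP A_inv).
have B'K := is_op_inverseK (op_invP B_inv).
have SK := is_op_inverseK (is_op_inverseC S_pos.1.1 (op_invP S_inv)).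
set P := _ *: _ in PK *.
exists X => // r x; set u := op_inv P x.
have uE : P u = x by exact: PK.
have [S_lin X_lin] : linear S /\ linear X by split; [exact: S_pos.1.1.1|exact: X_pos.1.1.1].
exists ((2^-1)%:C *: S (op_inv B u)); set y := op_inv B u.
set w := _ *: S y.
have Sy : S y = w + w.
  by rewrite half_twice.
have uw : u = S (X (X w) + X (X w)).
  by rewrite -(linD X_lin) -(linD X_lin) -Sy -Bv B'K.
have SA' : S (op_inv A u) = X (X w) + X (X w).
  by apply: (can_inj SK); rewrite -uw -Av A'K.
have Sx : S x = w + X (X w).
  rewrite -uE /P !fctE (linZ S_lin) (linD S_lin) SA' -/y Sy.
  by rewrite addrACA scalerDr half_twice addrC.
have -> : (r%:C *: (S \o X \o S) + (1 - r)%:C *: ((2^-1)%:C *: (A + B))) x =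
  r%:C *: S (X (S x)) + (1 - r)%:C *: ((2^-1)%:C *: (S (S x) + S (X (X (S x))))).
  by rewrite !fctE Av Bv.
rewrite uw !(rdotDr, rdotZr) -!(rdot_sym S_pos.1 x).
by rewrite /mean_gap -Sx (rdot_sym X_pos.1 (S x)) rdotDr.
Qed.

End Means.

Theorem proposition1p1 (R : realType) (H : completeNormedModType R[i])
    (ip : {dot H for (@conjC R[i])}) (ip_norm : induces_norm ip)
    (A B : H -> H)
    (A_pos : positive_operator ip A) (A_inv : invertible_operator A)
    (B_pos : positive_operator ip B) (B_inv : invertible_operator B)
    (r : R) :
  (2 <= r ->
     op_le ip
       (r%:C *: geometric_mean ip A B + (1 - r)%:C *: (2^-1 *: (A + B)))
       (op_inv (2^-1 *: (op_inv A + op_inv B)))) /\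
  (r <= 1 ->
     op_le ip
       (op_inv (2^-1 *: (op_inv A + op_inv B)))
       (r%:C *: geometric_mean ip A B + (1 - r)%:C *: (2^-1 *: (A + B)))).
Proof.
rewrite half_real.
have [P_pos P_inv] := harmonic_mean_invertible ip_norm A_pos A_inv B_pos B_inv.
have [X X_pos gapE] := mean_gap_form ip_norm A_pos A_inv B_pos B_inv.
have harm_sa := (op_inverse_positive P_pos (op_invP P_inv)).1.
have mean_sa : self_adjoint ip
    (r%:C *: geometric_mean ip A B + (1 - r)%:C *: ((2^-1)%:C *: (A + B))).
  apply: self_adjointD; last first.
    by do 2!apply: self_adjointZ; exact: self_adjointD A_pos.1 B_pos.1.
  apply: self_adjointZ.
  have [S [Y [[S_pos _] Y_pos _ _ ->]]] :=
    geometric_mean_factor ip_norm A_pos A_inv B_pos B_inv.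
  exact: (positive_congruence S_pos.1 Y_pos).1.
split=> r_bound; split=> //.
  apply: positive_of_rdot => [|x]; first exact: self_adjointB harm_sa mean_sa.
  have [w] := gapE r x; rewrite [_ x]/= rdotBr => ->; exact: mean_gap_ge0.
apply: positive_of_rdot => [|x]; first exact: self_adjointB mean_sa harm_sa.
have [w] := gapE r x; rewrite rdotBr => gap.
by rewrite -oppr_le0 opprB gap; exact: mean_gap_le0.
Qed.
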